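(* Let $p>5$ be a prime. Then: - if $p\equiv 1\pmod{12}$ and $p=A^2+3B^2$ with $A,B\in\mathbb{Z}$ and $3\mid A-1$, then $$P_{[p/6]}\!\left(\frac{11\sqrt 5}{25}\right)\equiv 5^{\frac{p-1}{4}}\left(\frac 5p\right)2A\pmod p;$$ - if $p\equiv 7\pmod{12}$ and $p=A^2+3B^2$ with $A,B\in\mathbb{Z}$ and $3\mid A-1$, then $$P_{[p/6]}\!\left(\frac{11\sqrt 5}{25}\right)\equiv -5^{\frac{p-3}{4}}\left(\frac 5p\right)2A\sqrt 5\pmod p;$$ - if $p\equiv 2\pmod 3$, then $P_{[p/6]}\!\left(\frac{11\sqrt 5}{25}\right)\equiv 0\pmod p$.
   Context: $\left(\frac{5}{p}\right)$ is the Legendre symbol. $[x]$ is the greatest integer not exceeding $x$. $P_n(x)$ is the $n$-th Legendre polynomial: $P_0(x)=1$, $P_1(x)=x$, $(n+1)P_{n+1}(x)=(2n+1)xP_n(x)-nP_{n-1}(x)$ for $n\ge 1$. Congruences modulo $p$ are in $R_p[\sqrt{5}]=\{u+v\sqrt{5}:u,v\in R_p\}$, where $R_p$ is the ring of rational numbers whose denominator is coprime to $p$: $\alpha\equiv\beta\pmod p$ means $\alpha-\beta\in pR_p[\sqrt{5}]$. *)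

(* Defs.v *)
From mathcomp Require Import all_boot all_order all_algebra all_field.

Set Implicit Arguments.
Unset Strict Implicit.
Unset Printing Implicit Defensive.

Import Order.TTheory GRing.Theory Num.Theory.
Local Open Scope ring_scope.

(* The congruences below involve sqrt 5; all values are taken in algC, with  *)
(* sqrtC 5 the nonnegative square root of 5.                                 *)

Fixpoint legendre_poly (n : nat) : {poly algC} :=
  match n with
  | 0%N => 1
  | m.+1 =>
    match m with
    | 0%N => 'X
    | k.+1 => m.+1%:R^-1 *: ((2 * m + 1)%N%:R *: ('X * legendre_poly m)
                             - m%:R *: legendre_poly k)
    end
  end.

Lemma legendre_poly0 : legendre_poly 0 = 1.
Proof. by []. Qed.

Lemma legendre_poly1 : legendre_poly 1 = 'X.
Proof. by []. Qed.

Lemma legendre_poly_rec (n : nat) : (0 < n)%N ->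
  n.+1%:R *: legendre_poly n.+1 =
    (2 * n + 1)%N%:R *: ('X * legendre_poly n) - n%:R *: legendre_poly n.-1.
Proof.
by case: n => // n _; rewrite [in LHS]/= scalerA mulfV ?pnatr_eq0 // scale1r.
Qed.

(* Only meaningful for p prime: 'F_p is the field with pdiv p elements.      *)
Definition legendre_symbol (a : int) (p : nat) : int :=
  if (p %| a)%Z then 0
  else if [exists x : 'F_p, x ^+ 2 == a%:~R] then 1 else -1.

Definition Rp (p : nat) : {pred rat} := fun r => coprime `|denq r|%N p.

Definition Rp_sqrt5 (p : nat) (z : algC) : Prop :=
  exists u v : rat,
    [/\ u \in Rp p, v \in Rp p & z = ratr u + ratr v * sqrtC 5].

Definition eqmod_Rp_sqrt5 (p : nat) (a b : algC) : Prop :=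
  exists2 z : algC, Rp_sqrt5 p z & a - b = p%:R * z.

(* Main.v *)
Require Import Defs.
From mathcomp Require Import all_boot all_order all_algebra all_field.
From mathcomp Require Import all_solvable ring zify.

Set Implicit Arguments.
Unset Strict Implicit.
Unset Printing Implicit Defensive.

Import Order.TTheory GRing.Theory Num.Theory.
Local Open Scope ring_scope.

(** Write p = 2m + 1, n = [p/6] = [m/3], s = sqrt 5, and let chi be the
    quadratic character of F_p.  The number governing the congruence is
      S = sum over x in F_p of chi (x^3 - 15 x + 22),
    the trace term of an elliptic curve with complex multiplication by
    Z[sqrt (-3)].  The proof relates P_n to S, and then evaluates S.

    From P_n to S.  Around t = 1 one has the expansion
      P_n(t) = sum over k of C(n,k) C(n+k,k) ((t-1)/2)^k.
    In characteristic p, m = -1/2 and n (n + 1) = -5/36, whatever p is modulo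
    6.  With these values the coefficients above satisfy the same two-term
    recursion as those of the coefficient of X^(p-1) in
    (X^2 (X + 3) + 2 (t - 1))^m, so that this coefficient is 3^m P_n(t)
    (legendre_sum_coef).  Now X^2 (X + 3) + 2 (t - 1) is X^3 - 3 X + 2 t
    translated by 1, and translation does not change the coefficient of
    X^(p-1) in a polynomial of degree less than 2 (p - 1), because that
    coefficient is minus the sum of the values of the polynomial over F_p
    (sum_horner_coef).  At t = 11 s / 25 the substitution of X / s for X turns
    X^3 - 3 X + 2 t into X^3 - 15 X + 22, and Euler's criterion then gives
      s^m 3^m P_n(11 s / 25) = - S   (legendre_sum_trace),
    in any field of characteristic p that contains s.  As s may be missing from
    F_p, the identity is proved in an extension and brought back to F_p by means
    of the integers W_n = (5 s)^n n! P_n(11 s / 25), which satisfy a recurrence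
    with integer coefficients (scaled_legendreE, scaled_legendre_trace).

    Evaluation of S.  The cubic has the root 2, and the 2-isogeny attached to it
    leads to y^2 = x^3 + 1, so that S is the sum of the chi (x^3 + 1)
    (sum_quad_char_2isogeny, sum_quad_char_curve).  If p = 2 mod 3, cubing
    permutes F_p and S = 0.  If p = 1 mod 3, the first two moments of the family
    of curves y^2 = x^3 + k yield S^2 + 3 b^2 = 4 p for some integer b
    (cubic_sum_norm); moreover S is even and S = 1 mod 3, and since p is of the
    form A^2 + 3 B^2 for only one value of A^2, these facts force S = - 2 A
    (cubic_sum_eq).

    The powers of 5 and the signs in the theorem come from s^2 = 5, from
    5^m = (5/p), and, for p = 1 mod 3, from (3/p) = (-1)^m (quad_char_3). *)

(** * The quadratic character of a finite field *)

Definition quad_char (F : finFieldType) (x : F) : int :=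
  if x == 0 then 0 else if [exists y, y ^+ 2 == x] then 1 else -1.

Section QuadraticCharacter.
Variables (F : finFieldType) (m : nat).
Hypothesis card_F : #|F| = m.*2.+1.
Implicit Types x y : F.
Local Notation chi := (@quad_char F).

Lemma half_order_gt0 : (0 < m)%N.
Proof. by have := finNzRing_gt1 F; rewrite card_F; case: m. Qed.

Lemma double_half_gt0 : (0 < m.*2)%N.
Proof. by rewrite double_gt0 half_order_gt0. Qed.

Lemma expf_order x : x != 0 -> x ^+ m.*2 = 1.
Proof.
by move=> x0; apply: (mulfI x0); rewrite -exprS -card_F expf_card mulr1.
Qed.

Lemma exists_generator : exists g : F, (m.*2).-primitive_root g.
Proof.
pose rs := enum (predC1 (0 : F)).
suff /hasP[g _ g_prim] : has (m.*2).-primitive_root rs by exists g.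
apply: has_prim_root double_half_gt0 _ (enum_uniq _) _.
  by apply/allP=> x; rewrite mem_enum unity_rootE => /expf_order->.
by rewrite -cardE cardC1 card_F.
Qed.

Lemma natf_order_neq0 : (m.*2)%:R != 0 :> F.
Proof.
by have [g g_prim] := exists_generator; apply: prim_root_natf_neq0 g_prim.
Qed.

Lemma two_neq0 : 2 != 0 :> F.
Proof.
by have := natf_order_neq0; rewrite -muln2 natrM mulf_eq0 negb_or => /andP[].
Qed.

Section Generator.
Variable g : F.
Hypothesis g_prim : (m.*2).-primitive_root g.

Lemma generator_neq0 : g != 0.
Proof. by rewrite (prim_root_eq0 g_prim) -lt0n double_half_gt0. Qed.

Lemma generatorP x : x != 0 -> exists i, x = g ^+ i.
Proof.
by move=> /expf_order/(prim_rootP g_prim)[i ->]; exists i.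
Qed.

Lemma big_generator (V : zmodType) (H : F -> V) :
  \sum_(x | x != 0) H x = \sum_(i < m.*2) H (g ^+ i).
Proof.
rewrite -big_filter -(big_map (fun i : 'I__ => g ^+ i) xpredT H).
apply: perm_big; apply: uniq_perm.
- exact: filter_uniq (index_enum_uniq _).
- rewrite map_inj_uniq ?index_enum_uniq // => i j /eqP.
  by rewrite (eq_prim_root_expr g_prim) !modn_small // => /eqP/val_inj.
move=> x; rewrite mem_filter mem_index_enum andbT.
apply/idP/mapP => [x0 | [i _ ->]]; last by rewrite expf_neq0 ?generator_neq0.
have [i ->] := prim_rootP g_prim (expf_order x0).
by exists i; rewrite ?mem_index_enum.
Qed.

Lemma generator_half : g ^+ m = -1.
Proof.
apply/eqP; have := expf_order generator_neq0.
rewrite -mul2n mulnC exprM => /eqP; rewrite sqrf_eq1 => /orP[] //.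
rewrite -(expr0 g) (eq_prim_root_expr g_prim) mod0n modn_small.
  by rewrite eqn0Ngt half_order_gt0.
by rewrite -addnn -[X in (X < _)%N]addn0 ltn_add2l half_order_gt0.
Qed.

Lemma quad_char_generator i : chi (g ^+ i) = (-1) ^+ i.
Proof.
rewrite /quad_char expf_eq0 (negPf generator_neq0) andbF.
case: ifP => [/existsP[y /eqP yi] | /negbT /existsPn ni].
  have y0 : y != 0.
    apply: contraNneq (expf_neq0 i generator_neq0) => y0.
    by rewrite -yi y0 expr0n.
  have : (g ^+ i) ^+ m = 1 by rewrite -yi -exprM mul2n expf_order.
  rewrite -exprM mulnC exprM generator_half -(signr_odd F) -(signr_odd int).
  case: (odd i) => //; rewrite expr1 => /eqP.
  by rewrite -subr_eq0 -opprD oppr_eq0 -mulr2n (negPf two_neq0).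
rewrite -signr_odd; case oi: (odd i) => //; have := ni (g ^+ i./2).
by rewrite -exprM muln2 -[X in _ == _ ^+ X]odd_double_half oi eqxx.
Qed.

End Generator.

Lemma quad_char0 : chi 0 = 0. Proof. by rewrite /quad_char eqxx. Qed.

Lemma quad_charM x y : chi (x * y) = chi x * chi y.
Proof.
have [-> | x0] := eqVneq x 0; first by rewrite mul0r quad_char0 mul0r.
have [-> | y0] := eqVneq y 0; first by rewrite mulr0 quad_char0 mulr0.
have [g g_prim] := exists_generator.
have [i ->] := generatorP g_prim x0; have [j ->] := generatorP g_prim y0.
by rewrite -exprD !(quad_char_generator g_prim) exprD.
Qed.

Lemma quad_char_sqr x : x != 0 -> chi (x ^+ 2) = 1.
Proof.
move=> x0; rewrite /quad_char expf_eq0 (negPf x0) andbF.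
by case: existsP => // -[]; exists x.
Qed.

Lemma sqr_quad_char x : x != 0 -> chi x ^+ 2 = 1.
Proof.
by move=> x0; rewrite /quad_char (negPf x0); case: ifP => // _; rewrite sqrrN.
Qed.

Lemma quad_char1 : chi 1 = 1.
Proof. by rewrite -(expr1n _ 2) quad_char_sqr ?oner_eq0. Qed.

Lemma Euler_criterion x : (chi x)%:~R = x ^+ m.
Proof.
have [-> | x0] := eqVneq x 0.
  by rewrite quad_char0 expr0n; case: m half_order_gt0.
have [g g_prim] := exists_generator.
have [i ->] := generatorP g_prim x0.
rewrite (quad_char_generator g_prim) -exprM mulnC exprM.
by rewrite (generator_half g_prim) rmorphXn rmorphN1.
Qed.

Lemma sum_quad_char : \sum_x chi x = 0.
Proof.
have [g g_prim] := exists_generator; have g0 := generator_neq0 g_prim.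
have : \sum_x chi x = - \sum_x chi x.
  rewrite {1}(reindex_inj (mulfI g0)) /= -sumrN; apply: eq_bigr => x _.
  by rewrite quad_charM -[X in chi X]expr1 (quad_char_generator g_prim) mulN1r.
lia.
Qed.

Lemma sum_quad_char_shift a : \sum_x chi (x + a) = 0.
Proof.
by rewrite -[RHS]sum_quad_char [RHS](reindex_inj (addIr a)).
Qed.

Lemma card_sqrt d : #|[set u | u ^+ 2 == d]|%:Z = 1 + chi d.
Proof.
rewrite /quad_char; case: eqP => [-> | /eqP d0].
  rewrite (_ : [set u | _] = [set 0]) ?cards1 //.
  by apply/setP=> u; rewrite !inE expf_eq0.
case: existsP => [[y /eqP yd] | nd].
  rewrite (_ : [set u | _] = [set y; - y]); last first.
    by apply/setP=> u; rewrite !inE -yd eqf_sqr.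
  rewrite cards2 -subr_eq0 opprK -mulr2n -mulr_natr mulf_eq0 negb_or two_neq0.
  suff -> : y != 0 by [].
  by apply: contraNneq d0 => y0; rewrite -yd y0 expr0n.
rewrite (_ : [set u | _] = set0) ?cards0 //.
by apply/setP=> u; rewrite !inE; apply/negP=> ud; apply: nd; exists u.
Qed.

End QuadraticCharacter.

(** * Counting solutions and summing powers *)

Section CharacterSums.
Variables (F : finFieldType) (m : nat).
Hypothesis card_F : #|F| = m.*2.+1.
Local Notation chi := (@quad_char F).

(** The condition is u^2 - r u + b = 0, a quadratic equation of discriminant
    r^2 - 4 b; u = 0 is never a root because b is not zero. *)
Lemma card_reciprocal_sum (b r : F) : b != 0 ->
  #|[set u | (u != 0) && (u + b / u == r)]|%:Z = 1 + chi (r ^+ 2 - 4 * b).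
Proof.
move=> b0; have F2 := two_neq0 card_F; rewrite -(card_sqrt card_F).
(* 2 u - r is a square root of the discriminant. *)
have bij : bijective (fun u : F => 2 * u - r).
  by apply: injF_bij => u v /addIr/(mulfI F2).
rewrite -[in RHS](on_card_preimset (onW_bij _ bij)).
congr (Posz _); apply: eq_card => u; rewrite !inE.
rewrite -[in RHS]subr_eq0.
have -> : (2 * u - r) ^+ 2 - (r ^+ 2 - 4 * b) = 2 ^+ 2 * (u * (u - r) + b).
  by ring.
rewrite mulf_eq0 expf_eq0 (negPf F2) andbF /=.
have [-> | u0] := eqVneq u 0; first by rewrite /= mul0r add0r (negPf b0).
rewrite -(inj_eq (mulfI u0)) -subr_eq0 mulrDr mulrCA divff // mulr1.
by congr (_ == 0); ring.
Qed.

(** Replacing x by g x, with g a generator, multiplies the sum by g^k, which is 1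
    only if q - 1 divides k. *)
Lemma sum_expr k :
  \sum_(x : F) x ^+ k = if (0 < k)%N && (m.*2 %| k)%N then -1 else 0.
Proof.
have cF : #|F|%:R = 0 :> F.
  have : \sum_(x : F) (x + 1) = \sum_(x : F) x.
    by rewrite [RHS](reindex_inj (addIr 1)).
  rewrite big_split /= sumr_const => /(canRL (addKr _)).
  by rewrite addNr => <-.
have [-> | k0] := posnP k.
  by under eq_bigr do rewrite expr0; rewrite sumr_const /=.
have [kd | knd] := boolP (_ %| k)%N => /=.
  rewrite (bigD1 0) //= expr0n eqn0Ngt k0 add0r.
  rewrite (eq_bigr (fun => 1)) => [|x x0]; last first.
    by have [j ->] := dvdnP kd; rewrite mulnC exprM (expf_order card_F x0) expr1n.
  rewrite sumr_const cardC1 -subn1 natrB ?cF ?sub0r //.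
  by rewrite ltnW // finNzRing_gt1.
have [g g_prim] := exists_generator card_F.
have g0 := generator_neq0 card_F g_prim.
have/eqP : (g ^+ k - 1) * \sum_(x : F) x ^+ k = 0.
  rewrite mulrBl mul1r {2}(reindex_inj (mulfI g0)) /= mulr_sumr.
  by apply/eqP; rewrite subr_eq0; apply/eqP/eq_bigr => x _; rewrite exprMn.
rewrite mulf_eq0 subr_eq0 -(expr0 g) (eq_prim_root_expr g_prim) mod0n.
by rewrite -/(dvdn _ _) (negPf knd) => /eqP.
Qed.

(** Below degree 2 (q - 1), X^(q-1) is the only monomial whose values over F_q
    have a nonzero sum.  The polynomial may have coefficients in an extension K
    of F: this is what makes the coefficient of X^(q-1) invariant under
    translations by elements of F, even for coefficients outside F. *)
Lemma sum_horner_coef (K : fieldType) (phi : {rmorphism F -> K}) (P : {poly K}) :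
  (size P <= m.*2.*2)%N -> \sum_(x : F) P.[phi x] = - P`_m.*2.
Proof.
move=> sP; have m0 := double_half_gt0 card_F.
under eq_bigr => x _ do rewrite (horner_coef_wide _ sP).
rewrite exchange_big /=.
have lm : (m.*2 < m.*2.*2)%N by lia.
rewrite (bigD1 (Ordinal lm)) //= -mulr_sumr.
under [X in _ * X]eq_bigr do rewrite -rmorphXn.
rewrite -rmorph_sum sum_expr m0 dvdnn rmorphN1 mulrN1 big1 ?addr0 // => i ine.
rewrite -mulr_sumr; under eq_bigr do rewrite -rmorphXn.
rewrite -rmorph_sum sum_expr; case: ifP => [/andP[i0 /dvdnP[j ij]]|]; last first.
  by rewrite rmorph0 mulr0.
case: eqP ine => // -[]; apply: val_inj => /=.
have := ltn_ord i; rewrite ij in i0 *; move: i0 m0; rewrite -!mul2n.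
case: j {ij} => [|[|j]]; rewrite ?mul1n //; nia.
Qed.

End CharacterSums.

(** * Character sums of cubics *)

Section CurveSums.
Variables (F : finFieldType) (m : nat).
Hypothesis card_F : #|F| = m.*2.+1.
Local Notation chi := (@quad_char F).

(** Trace equality for the 2-isogenous curves y^2 = u (u^2 + a u + b) and
    y^2 = w (w^2 - 2 a w + a^2 - 4 b).  Up to the square u^2, the left-hand term
    is chi (r + a) with r = u + b / u; the number of u that give r is
    1 + chi (r^2 - 4 b), and w = r + a. *)
Lemma sum_quad_char_2isogeny (a b : F) : b != 0 ->
  \sum_u chi (u * (u ^+ 2 + a * u + b)) =
  \sum_w chi (w * (w ^+ 2 - 2 * a * w + (a ^+ 2 - 4 * b))).
Proof.
move=> b0; rewrite (bigD1 0) //= mul0r quad_char0 add0r.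
rewrite (eq_bigr (fun u => chi (u + b / u + a))) => [|u u0]; last first.
  rewrite (_ : u * _ = u ^+ 2 * (u + b / u + a)); last by field.
  by rewrite (quad_charM card_F) quad_char_sqr // mul1r.
rewrite (partition_big (fun u => u + b / u) xpredT) //=.
rewrite (eq_bigr (fun r => chi (r + a) + chi ((r + a) * (r ^+ 2 - 4 * b)))).
  rewrite big_split /= (sum_quad_char_shift card_F) add0r.
  rewrite [RHS](reindex_inj (addIr a)) /=; apply: eq_bigr => r _.
  by congr chi; ring.
move=> r _; rewrite (eq_bigr (fun => chi (r + a))) => [|u /andP[_ /eqP->] //].
rewrite sumr_const -[LHS]mulr_natr (quad_charM card_F).
transitivity (chi (r + a) * (1 + chi (r ^+ 2 - 4 * b))); last by ring.
by rewrite -(card_reciprocal_sum card_F) // cardsE natz.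
Qed.

(** With x = u + 2 the left-hand cubic becomes u (u^2 + 6 u - 3), whose
    2-isogenous cubic w (w^2 - 12 w + 48) is (w - 4)^3 + 64. *)
Lemma sum_quad_char_curve : 3 != 0 :> F ->
  \sum_x chi (x ^+ 3 - 15 * x + 22) = \sum_x chi (x ^+ 3 + 1).
Proof.
move=> F3; have F2 := two_neq0 card_F.
have inj4 : injective (fun z : F => 4 * z + 4).
  move=> y z /addIr; apply: mulfI.
  by rewrite (_ : 4 = 2 ^+ 2 :> F) ?expf_neq0 //; ring.
rewrite (reindex_inj (addIr (2 : F))) /=.
rewrite (eq_bigr (fun u => chi (u * (u ^+ 2 + 6 * u + (-3))))) => [|u _]; last first.
  by congr chi; ring.
rewrite sum_quad_char_2isogeny ?oppr_eq0 // (reindex_inj inj4) /=.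
apply: eq_bigr => z _.
rewrite [X in chi X = _](_ : _ = (2 ^+ 3) ^+ 2 * (z ^+ 3 + 1)); last by ring.
by rewrite (quad_charM card_F) quad_char_sqr ?mul1r // expf_neq0.
Qed.

Lemma sum_quad_char_cubic_bij : injective (fun x : F => x ^+ 3) ->
  \sum_x chi (x ^+ 3 + 1) = 0.
Proof.
move=> inj3; rewrite -[RHS](sum_quad_char_shift card_F 1).
by rewrite [RHS](reindex_inj inj3).
Qed.

(** Orthogonality of the translates of chi.  For a <> b the sum is that of
    chi (k (k + d)) with d = b - a nonzero; up to the square k^2 this is
    chi (1 + d / k), where 1 + d / k takes every value but 1. *)
Lemma sum_quad_char_mul_shift (a b : F) :
  \sum_k chi (a + k) * chi (b + k) = #|F|%:Z * (a == b)%:R - 1.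
Proof.
rewrite (reindex_inj (addrI (- a))) /=.
rewrite (eq_bigr (fun k => chi (k * (k + (b - a))))) => [|k _]; last first.
  by rewrite -(quad_charM card_F); congr chi; ring.
have [-> | ab] := eqVneq a b.
  rewrite subrr (bigD1 0) //= mul0r quad_char0 add0r.
  rewrite (eq_bigr (fun => 1)) => [|k k0]; last by rewrite addr0 -expr2 quad_char_sqr.
  by rewrite sumr_const cardC1 card_F /=; lia.
have d0 : b - a != 0 by rewrite subr_eq0 eq_sym.
rewrite (bigD1 0) //= mul0r quad_char0 add0r mulr0 sub0r.
have := sum_quad_char_shift card_F 1.
rewrite (bigD1 0) //= add0r quad_char1 => /(canRL (addKr _)).
rewrite addr0 => <-.
have bij_on : {on [pred u : F | u != 0], bijective (fun k : F => (b - a) / k)}.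
  have inv (k : F) : k != 0 -> (b - a) / ((b - a) / k) = k.
    by move=> k0; field; rewrite k0 d0.
  by exists (fun k : F => (b - a) / k) => k;
    rewrite inE => k0; apply: inv; move: k0; rewrite ?mulf_eq0 ?invr_eq0 ?(negPf d0).
rewrite [RHS](reindex _ bij_on) /=.
apply: eq_big => [k | k k0]; first by rewrite mulf_eq0 invr_eq0 (negPf d0).
rewrite (_ : k * _ = k ^+ 2 * ((b - a) / k + 1)); last by field.
by rewrite (quad_charM card_F) quad_char_sqr // mul1r.
Qed.
End CurveSums.

(** * The curves y^2 = x^3 + k when 3 divides q - 1 *)

Section CubicCurveTrace.
Variables (F : finFieldType) (m r : nat).
Hypothesis card_F : #|F| = m.*2.+1.
Hypothesis order_F : m.*2 = (3 * r)%N.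
Local Notation chi := (@quad_char F).

Definition cubic_sum (k : F) : int := \sum_x chi (x ^+ 3 + k).
(** Up to a sign, the sum attached to k only depends on the class of k modulo
    cubes; the factor chi k removes this sign. *)
Definition twisted_cubic_sum (k : F) : int := chi k * cubic_sum k.
Local Notation S := cubic_sum.
Local Notation T := twisted_cubic_sum.

Lemma sumrN1 : \sum_(x : F) (-1) = - #|F|%:Z.
Proof. by rewrite sumr_const -mulr_natr mulN1r natz. Qed.

Lemma cubic_sumM t k : t != 0 -> S (t ^+ 3 * k) = chi (t ^+ 3) * S k.
Proof.
move=> t0; rewrite /S mulr_sumr (reindex_inj (mulfI t0)); apply: eq_bigr => x _.
by rewrite -(quad_charM card_F) /= exprMn mulrDr.
Qed.

Lemma twisted_cubic_sumM t k : t != 0 -> T (t ^+ 3 * k) = T k.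
Proof.
move=> t0; rewrite /T cubic_sumM // (quad_charM card_F) mulrACA -expr2.
by rewrite sqr_quad_char ?expf_neq0 // mul1r.
Qed.

Lemma sum_twisted_cubic_sum : \sum_k T k = 0.
Proof.
under eq_bigr do rewrite /T /S mulr_sumr.
rewrite exchange_big /=.
rewrite (eq_bigr (fun x => #|F|%:Z * (x == 0)%:R - 1)) => [|x _]; last first.
  rewrite -[x == 0](expf_eq0 x 3) [_ == 0]eq_sym -(sum_quad_char_mul_shift card_F).
  by apply: eq_bigr => k _; rewrite add0r.
rewrite big_split /= -mulr_sumr sumrN1 (bigD1 0) //= eqxx big1 => [|x /negPf->//].
by rewrite addr0 mulr1 subrr.
Qed.

Section Generator.
Variable g : F.
Hypothesis g_prim : (m.*2).-primitive_root g.

(** The powers 1, g, g^2 of a generator represent the three classes modulo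
    cubes, each of which has r elements. *)
Lemma sum_cube_classes (H : F -> int) :
    (forall t k, t != 0 -> H (t ^+ 3 * k) = H k) ->
  \sum_(k | k != 0) H k = r%:Z * (H 1 + H g + H (g ^+ 2)).
Proof.
move=> H3; rewrite (big_generator card_F g_prim) order_F.
rewrite -(big_mkord xpredT (fun i => H (g ^+ i))).
have g0 := generator_neq0 card_F g_prim.
elim: r => [|j IHj]; first by rewrite muln0 big_nil mul0r.
have e i : H (g ^+ (3 * j + i)) = H (g ^+ i).
  by rewrite exprD mulnC exprM H3 // expf_neq0.
have := (e 0%N, e 1%N, e 2%N).
rewrite addn0 addn1 addn2 expr0 expr1 => -[[e0 e1] e2].
rewrite mulnS addnC !addnS addn0 !big_nat_recr //= {}IHj e0 e1 e2; lia.
Qed.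

Lemma card_cube_roots x : x != 0 -> #|[set y : F | y ^+ 3 == x ^+ 3]| = 3%N.
Proof.
move=> x0; have w_prim : 3.-primitive_root (g ^+ r).
  have := exp_prim_root g_prim r; rewrite order_F gcdnMl mulnK //.
  by have := double_half_gt0 card_F; rewrite order_F; case: r.
rewrite (_ : [set _ | _] = [set x * (g ^+ r) ^+ i | i : 'I_3]).
  rewrite card_imset ?card_ord // => i j /(mulfI x0)/eqP.
  by rewrite (eq_prim_root_expr w_prim) !modn_small // => /eqP/val_inj.
apply/setP=> y; rewrite inE; apply/eqP/imsetP => [yx | [i _ ->]].
  have /(prim_rootP w_prim)[i yi] : (y / x) ^+ 3 = 1.
    by rewrite expr_div_n yx divff // expf_neq0.
  by exists i => //; rewrite -yi mulrC divfK.
by rewrite exprMn (exprAC (g ^+ r)) (prim_expr_order w_prim) expr1n mulr1.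
Qed.

Lemma cubic_sum0 : S 0 = 0.
Proof.
rewrite -(sum_quad_char card_F); apply: eq_bigr => x _; rewrite addr0.
have [-> | x0] := eqVneq x 0; first by rewrite expr0n.
by rewrite exprS (quad_charM card_F) quad_char_sqr ?mulr1.
Qed.

(** Expanding the square and summing over k first leaves, by orthogonality, the
    number of pairs (x, y) with x^3 = y^3, which is 1 + 3 (q - 1). *)
Lemma sum_sqr_twisted_cubic_sum :
  \sum_k T k ^+ 2 = 2 * #|F|%:Z * (#|F|%:Z - 1).
Proof.
transitivity (\sum_k S k ^+ 2).
  apply: eq_bigr => k _; have [-> | k0] := eqVneq k 0.
    by rewrite /T cubic_sum0 mulr0.
  by rewrite /T exprMn sqr_quad_char ?mul1r.
under eq_bigr do rewrite expr2 /S big_distrlr /=.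
rewrite exchange_big /=.
under eq_bigr do rewrite exchange_big /=.
under eq_bigr => x _ do under eq_bigr do rewrite (sum_quad_char_mul_shift card_F).
have row (x : F) : \sum_(y : F) (#|F|%:Z * (x ^+ 3 == y ^+ 3)%:R - 1) =
    #|F|%:Z * (if x == 0 then 1 else 3) - #|F|%:Z.
  rewrite big_split /= -mulr_sumr sumrN1.
  congr (_ * _ - _); case: ifP => [/eqP-> | /negbT x0].
    rewrite (bigD1 0) //= eqxx big1 // => y y0.
    by rewrite expr0n eq_sym expf_eq0 (negPf y0).
  transitivity (#|[set y : F | y ^+ 3 == x ^+ 3]|%:Z); last by rewrite card_cube_roots.
  rewrite -natz -sum1_card natr_sum [RHS]big_mkcond /=.
  by apply: eq_bigr => y _; rewrite inE eq_sym; case: eqP.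
under eq_bigr do rewrite row.
rewrite big_split /= -mulr_sumr sumr_const (bigD1 0) //= eqxx.
rewrite (eq_bigr (fun => 3)) => [|x /negPf->//].
by rewrite sumr_const cardC1 card_F /=; lia.
Qed.

(** Apart from x = 0, the x occur in triples with the same cube. *)
Lemma cubic_sum_mod3 : (3 %| S 1%R - 1)%Z.
Proof.
rewrite /S (bigD1 0) //= expr0n add0r quad_char1 [1 + _]addrC addrK.
rewrite (big_generator card_F g_prim) order_F mulSn mul2n -addnn.
rewrite !big_split_ord /=.
set a := \sum_(i < r) _; set b := \sum_(i < r) _; set c := \sum_(i < r) _.
have per j i : (g ^+ (j * r + i)) ^+ 3 = (g ^+ i) ^+ 3.
  rewrite -!exprM mulnDl -mulnA [(r * 3)%N]mulnC -order_F mulnC exprD exprM.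
  by rewrite (prim_expr_order g_prim) expr1n mul1r.
have -> : b = a by apply: eq_bigr => i _; have := per 1%N i; rewrite mul1n => ->.
have -> : c = a.
  by apply: eq_bigr => i _; have := per 2 i; rewrite mul2n -addnn -addnA => ->.
by apply/dvdzP; exists a; ring.
Qed.

(** chi takes an odd value except at the three roots of x^3 = -1, and q is
    odd. *)
Lemma cubic_sum_even : (2 %| S 1%R)%Z.
Proof.
have parity x : (2 %| chi x - (x != 0%R)%:R)%Z.
  rewrite /quad_char; case: eqP => // _; by case: ifP.
have -> : S 1 = \sum_x (chi (x ^+ 3 + 1) - (x ^+ 3 + 1 != 0)%:R)
              + \sum_(x : F) (x ^+ 3 + 1 != 0)%:R.
  by rewrite -big_split /=; apply: eq_bigr => x _; rewrite subrK.
apply: rpredD; first by apply: rpred_sum => x _; apply: parity.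
rewrite -natr_sum natz.
have N1 : (-1 : F) != 0 by rewrite oppr_eq0 oner_eq0.
have roots : (\sum_(x : F) (x ^+ 3 == (-1) ^+ 3)%R = 3)%N.
  rewrite -[RHS](card_cube_roots N1) -[RHS]sum1_card [RHS]big_mkcond /=.
  by apply: eq_bigr => x _; rewrite inE; case: eqP.
have : (\sum_(x : F) (x ^+ 3 + 1 != 0)%R + \sum_(x : F) (x ^+ 3 == (-1) ^+ 3)%R = #|F|)%N.
  rewrite -[RHS]sum1_card -big_split /=; apply: eq_bigr => x _.
  by rewrite addr_eq0 -[(-1) ^+ 3]signr_odd expr1; case: eqP.
rewrite roots card_F; move: (\sum_x _)%N => s even_s.
by apply/dvdzP; exists (m%:Z - 1); lia.
Qed.

End Generator.

(** Let a = S(1), u and v be the twisted sums at 1, g and g^2.  The first two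
    moments say that a + u + v = 0 and a^2 + u^2 + v^2 = 6 q; eliminating v
    yields (2 u + a)^2 + 3 a^2 = 12 q, so that 3 divides 2 u + a. *)
Lemma cubic_sum_norm : exists b : int, S 1 ^+ 2 + 3 * b ^+ 2 = 4 * #|F|%:Z.
Proof.
have [g g_prim] := exists_generator card_F.
have r0 : r%:Z != 0 by have := double_half_gt0 card_F; lia.
have T0 : T 0 = 0 by rewrite /T quad_char0 mul0r.
have T1 : T 1 = S 1 by rewrite /T quad_char1 mul1r.
have := sum_twisted_cubic_sum; rewrite (bigD1 0) //= T0 add0r.
rewrite (sum_cube_classes g_prim twisted_cubic_sumM) => /eqP.
rewrite mulf_eq0 (negPf r0) T1 => /eqP lin.
have := sum_sqr_twisted_cubic_sum g_prim; rewrite (bigD1 0) //= T0 expr0n add0r.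
rewrite (sum_cube_classes (H := fun k => T k ^+ 2) g_prim); last first.
  by move=> t k t0; rewrite twisted_cubic_sumM.
have -> : #|F|%:Z - 1 = r%:Z * 3 by rewrite card_F; lia.
rewrite mulrCA => /(mulfI r0); rewrite T1.
move: lin; move: (S 1) (T g) (T (g ^+ 2)) => a b c lin.
have -> : c = - a - b by lia.
move=> sq; have nrm : (2 * b + a) ^+ 2 = 3 * (4 * #|F|%:Z - a ^+ 2).
  transitivity (2 * (a ^+ 2 + b ^+ 2 + (- a - b) ^+ 2) - 3 * a ^+ 2); first by ring.
  by rewrite sq; ring.
have : (3 %| 2 * b + a)%Z.
  have : (3 %| (2 * b + a) ^+ 2)%Z by rewrite nrm dvdz_mulr.
  by rewrite !dvdzE abszX Euclid_dvdX // andbT.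
case/dvdzP=> d d3; exists d; apply: (mulfI (isT : (3 : int) != 0)).
move: nrm; rewrite d3 => nrm; transitivity (3 * a ^+ 2 + (d * 3) ^+ 2); first by ring.
by rewrite nrm; ring.
Qed.
End CubicCurveTrace.

(** * Representations by A^2 + 3 B^2 *)

(** p divides (A b - a B) (A b + a B).  By Brahmagupta's identity each factor d
    satisfies p^2 = c^2 + 3 d^2 for some c, so the factor that p divides must
    vanish, and then p A^2 = p a^2. *)
Lemma prime_norm_unique (p : nat) (A B a b : int) : prime p ->
  p%:Z = A ^+ 2 + 3 * B ^+ 2 -> p%:Z = a ^+ 2 + 3 * b ^+ 2 -> A ^+ 2 = a ^+ 2.
Proof.
move=> pr_p pAB pab; have p0 := prime_gt0 pr_p.
have cross : (A * b - a * B) * (A * b + a * B) = p%:Z * (b ^+ 2 - B ^+ 2).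
  by rewrite mulrBr {1}pAB pab; ring.
have pp : p%:Z ^+ 2 = (A ^+ 2 + 3 * B ^+ 2) * (a ^+ 2 + 3 * b ^+ 2).
  by rewrite -pAB -pab.
have small (c d : int) : p%:Z ^+ 2 = c ^+ 2 + 3 * d ^+ 2 -> (p %| d)%Z -> d = 0.
  move=> pcd /dvdzP[k dk]; rewrite dk in pcd *.
  have [-> | k0] := eqVneq k 0; first by rewrite mul0r.
  have k1 : 0 < k ^+ 2 by rewrite exprn_even_gt0 //= k0.
  have c0 := sqr_ge0 c; have p2 : 0 < p%:Z ^+ 2 by rewrite exprn_gt0.
  have := ler_peMl (ltW p2) (k1 : 1 <= k ^+ 2); move: pcd; rewrite exprMn.
  by move: (p%:Z ^+ 2) (c ^+ 2) (k ^+ 2 * _) c0 p2 => u v w; clear; lia.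
suff cross0 : (A * b - a * B) * (A * b + a * B) = 0.
  move: cross; rewrite cross0 => /esym/eqP; rewrite mulf_eq0.
  rewrite (negPf (_ : p%:Z != 0)) /=; last by lia.
  by rewrite subr_eq0 => /eqP bB; move: pAB; rewrite pab -bB => /addIr.
have : (p %| (A * b - a * B) * (A * b + a * B))%Z by rewrite cross dvdz_mulr.
rewrite dvdzE abszM Euclid_dvdM // => /orP[] pd.
  rewrite (small (A * a + 3 * B * b) (A * b - a * B)) ?mul0r //.
  by rewrite pp; ring.
rewrite (small (A * a - 3 * B * b) (A * b + a * B)) ?mulr0 //.
by rewrite pp; ring.
Qed.

(** Both S and b are even, so S / 2 is A or - A, and the residues modulo 3 select
    the sign. *)
Lemma cubic_sum_eq (p : nat) (A B S b : int) : prime p ->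
    p%:Z = A ^+ 2 + 3 * B ^+ 2 -> (3 %| A - 1)%Z ->
    S ^+ 2 + 3 * b ^+ 2 = 4 * p%:Z -> (3 %| S - 1)%Z -> (2 %| S)%Z ->
  S = - (2 * A).
Proof.
move=> pr_p pAB A3 nrm S3 /dvdzP[a Sa].
have /dvdzP[c bc] : (2 %| b)%Z.
  have : (2 %| 3 * b ^+ 2)%Z.
    by apply/dvdzP; exists (2 * (p%:Z - a ^+ 2)); move: nrm; rewrite Sa; nia.
  by rewrite Gauss_dvdzr // !dvdzE abszX Euclid_dvdX // andbT.
have : A ^+ 2 = a ^+ 2.
  by apply: (prime_norm_unique pr_p pAB (b := c)); move: nrm; rewrite Sa bc; nia.
move/eqP; rewrite eqf_sqr => /orP[] /eqP Aa; last by lia.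
by case/dvdzP: A3 S3 => k Ak /dvdzP[l Sl]; lia.
Qed.

(** * The expansion of Legendre polynomials around 1 *)

(** This product is C(n,k) C(n+k,k); in the present form only one factor depends
    on n, which makes Pascal's rule in n immediate. *)
Definition legendre_coef n k : nat := ('C(n + k, k.*2) * 'C(k.*2, k))%N.

Arguments legendre_coef : simpl never.

Lemma legendre_coef_small n k : (n < k)%N -> legendre_coef n k = 0%N.
Proof. by move=> nk; rewrite /legendre_coef bin_small // -addnn ltn_add2r. Qed.

Lemma central_binS k : (k.+1 * 'C(k.+1.*2, k.+1) = 2 * k.*2.+1 * 'C(k.*2, k))%N.
Proof.
have e : ('C(k.*2.+1, k) = 'C(k.*2.+1, k.+1))%N.
  by rewrite -bin_sub; [congr 'C(_, _) | ]; lia.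
rewrite doubleS binS -{}e addnn -mul2n mulnCA -mulnA; congr (_ * _)%N.
by have := mul_bin_down k.*2.+1 k; rewrite /= (_ : k.*2.+1 - k = k.+1)%N //; lia.
Qed.

Lemma legendre_coef_recl n k :
  (k.+1 ^ 2 * legendre_coef n k.+1 = (n - k) * (n + k.+1) * legendre_coef n k)%N.
Proof.
rewrite /legendre_coef addnS doubleS.
have := mul_bin_left (n + k) k.*2; have := mul_bin_diag (n + k).+1 k.*2.+1 => /=.
have := central_binS k; rewrite doubleS (_ : n + k - k.*2 = n - k)%N; last by lia.
move: 'C(_, _) 'C(_, _) 'C(_, _) 'C(_, _) 'C(_, _) => a b c d e He Hb Hc.
apply/eqP; rewrite -(eqn_pmul2l (isT : 0 < 2)%N); apply/eqP.
transitivity (k.*2.+2 * b * (k.+1 * e))%N; first by rewrite -doubleS -mul2n; ring.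
rewrite -Hb He; transitivity (2 * (n + k).+1 * d * (k.*2.+1 * c))%N; first by ring.
by rewrite Hc; ring.
Qed.

(** The coefficients of y^(k+1) in the Legendre recurrence at x = 1 + 2 y. *)
Lemma legendre_coef_rec n k :
  (n.+2 * legendre_coef n.+2 k.+1 + n.+1 * legendre_coef n k.+1 =
   n.*2.+3 * (legendre_coef n.+1 k.+1 + 2 * legendre_coef n.+1 k))%N.
Proof.
rewrite /legendre_coef !addSn !addnS doubleS.
have pascal2 M j : 'C(M.+2, j.+2) = ('C(M, j.+2) + 2 * 'C(M, j.+1) + 'C(M, j))%N.
  by rewrite !binS; ring.
have := mul_bin_left (n + k).+1 k.*2; have := central_binS k; rewrite doubleS.
rewrite pascal2 (binS (n + k).+1).
move: 'C(_, k.+1) 'C(k.*2, k) => e f.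
have [nk | nk] := ltnP n.+1 k.
  rewrite (_ : (n + k).+1 - k.*2 = 0)%N; last by lia.
  rewrite ['C(_, k.*2)]bin_small; last by lia.
  rewrite ['C(_, k.*2.+1)]bin_small; last by lia.
  by rewrite ['C(_, k.*2.+2)]bin_small => [_ _|]; [ring | lia].
rewrite (_ : (n + k).+1 - k.*2 = n.+1 - k)%N; last by lia.
move: 'C(_, k.*2.+2) 'C(_, k.*2.+1) 'C(_, k.*2) => a b d He Hb.
apply/eqP; rewrite -(eqn_pmul2l (ltn0Sn k)); apply/eqP.
transitivity ((k.+1 * e) * (n.*2.+3 * (a + b) + (b + n.+2 * d)))%N.
  by rewrite -mul2n; ring.
rewrite mulnDr {2}He.
transitivity (k.+1 * e * (n.*2.+3 * (a + b))
  + 2 * f * (k.*2.+1 * b + k.*2.+1 * n.+2 * d))%N.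
  by ring.
rewrite Hb -mulnDl (_ : n.+1 - k + k.*2.+1 * n.+2 = k.+1 * n.*2.+3)%N; last first.
  by rewrite -!mul2n; nia.
by ring.
Qed.

Section LegendreSum.
Variable K : fieldType.

(** The expansion of the Legendre polynomial around 1, which makes sense in every
    field of characteristic other than 2. *)
Definition legendre_sum n (x : K) : K :=
  \sum_(k < n.+1) (legendre_coef n k)%:R * ((x - 1) / 2) ^+ k.

Lemma legendre_sum_wide N n x : (n < N)%N ->
  legendre_sum n x = \sum_(k < N) (legendre_coef n k)%:R * ((x - 1) / 2) ^+ k.
Proof.
move=> nN; pose f k := (legendre_coef n k)%:R * ((x - 1) / 2) ^+ k.
rewrite /legendre_sum (big_ord_widen N f) // /f.
rewrite big_mkcond /=; apply: eq_bigr => k _; case: ltnP => // nk.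
by rewrite legendre_coef_small // mul0r.
Qed.

Lemma legendre_sum0 x : legendre_sum 0 x = 1.
Proof. by rewrite /legendre_sum big_ord1 mul1r. Qed.

Hypothesis K2 : 2 != 0 :> K.

Lemma legendre_sum1 x : legendre_sum 1 x = x.
Proof.
rewrite /legendre_sum !big_ord_recl big_ord0 /= mul1r expr1 expr0.
by rewrite (_ : legendre_coef 1 1 = 2)%N //; field.
Qed.

Lemma legendre_sum_rec n x :
  n.+2%:R * legendre_sum n.+2 x =
  n.*2.+3%:R * x * legendre_sum n.+1 x - n.+1%:R * legendre_sum n x.
Proof.
apply/(canRL (addrK _)).
set y := (x - 1) / 2; have -> : n.*2.+3%:R * x = n.*2.+3%:R * (1 + 2 * y).
  by congr (_ * _); rewrite /y; field.
rewrite -mulrA [(1 + _) * _]mulrDl mul1r.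
rewrite (legendre_sum_wide _ (leqW (leqW (leqnn n.+1)))).
rewrite {1}(legendre_sum_wide _ (leqW (leqnn n.+2))).
rewrite /legendre_sum -/y !(big_ord_recl n.+2) /= expr0 !mulr1.
have c0 j : legendre_coef j 0 = 1%N by rewrite /legendre_coef !bin0.
rewrite !c0; set u := \sum_(i < _) _; set v := \sum_(i < _) _.
set w := \sum_(i < _) _; set z := \sum_(i < _) _.
suff tail : n.+2%:R * u + n.+1%:R * v = n.*2.+3%:R * (w + 2 * y * z).
  transitivity (n.+2%:R + n.+1%:R + (n.+2%:R * u + n.+1%:R * v)); first by ring.
  rewrite tail -natrD (_ : n.+2 + n.+1 = n.*2.+3)%N; first by ring.
  by rewrite -addnn; lia.
rewrite /u /v /w /z {u v w z}.
rewrite !mulr_sumr -!big_split /= mulr_sumr; apply: eq_bigr => k _.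
rewrite /bump add1n exprS; have := legendre_coef_rec n k.
move: (legendre_coef n.+2 k.+1) (legendre_coef n k.+1) => a b.
move: (legendre_coef n.+1 k.+1) (legendre_coef n.+1 k) => c d.
move/(congr1 (fun i : nat => i%:R : K)).
rewrite [LHS]natrD [LHS]/= [RHS]natrM !natrM [in RHS]natrD => e.
transitivity ((n.+2%:R * a%:R + n.+1%:R * b%:R) * y * y ^+ k); first by ring.
by rewrite e natrM; ring.
Qed.
End LegendreSum.

(** * Coefficients in characteristic p *)

Lemma coef_XaddC_exp (R : comNzRingType) (c : R) N i :
  (('X + c%:P) ^+ N)`_i = c ^+ (N - i) *+ 'C(N, i).
Proof.
rewrite addrC exprDn coef_sum.
under eq_bigr do rewrite -rmorphXn coefMn mul_polyC coefZ coefXn.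
have [Ni | iN] := ltnP N i.
  rewrite bin_small // big1 // => j _.
  by rewrite (_ : _ == _ = false) ?mulr0 ?mul0rn //; have := ltn_ord j; lia.
rewrite (bigD1 (Ordinal (iN : (i < N.+1)%N))) //= eqxx mulr1 big1 ?addr0 // => j.
by rewrite -val_eqE /= eq_sym => /negPf->; rewrite mulr0 mul0rn.
Qed.

(** In the expansion of (X^2 (X + 3) + c)^m, the coefficient of X^(2m) is the sum
    of the curve_coef m k 3^(m-3k) c^k. *)
Definition curve_coef m k : nat := ('C(m, k) * 'C(m - k, k.*2))%N.
Arguments curve_coef : simpl never.

Lemma curve_coef_recl m k :
  (k.+1 * (k.*2.+2 * k.*2.+1) * curve_coef m k.+1 =
   (m - 3 * k) * (m - (3 * k).+1) * (m - (3 * k).+2) * curve_coef m k)%N.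
Proof.
rewrite /curve_coef doubleS.
have h1 := mul_bin_left m k.
have h2 : ((m - k) * 'C(m - k.+1, k.*2) = (m - 3 * k) * 'C(m - k, k.*2))%N.
  by rewrite subnS mul_bin_down; congr (_ * _)%N; lia.
have h3 : (k.*2.+1 * 'C(m - k.+1, k.*2.+1) = (m - (3 * k).+1) * 'C(m - k.+1, k.*2))%N.
  by rewrite mul_bin_left; congr (_ * _)%N; lia.
have h4 : (k.*2.+2 * 'C(m - k.+1, k.*2.+2) = (m - (3 * k).+2) * 'C(m - k.+1, k.*2.+1))%N.
  by rewrite mul_bin_left; congr (_ * _)%N; lia.
move: 'C(m - k.+1, k.*2.+2) 'C(m - k.+1, k.*2.+1) 'C(m - k.+1, k.*2) h2 h3 h4.
move: 'C(m, k.+1) 'C(m, k) 'C(m - k, k.*2) h1 => c d e h1 a b f h2 h3 h4.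
transitivity ((k.+1 * c) * k.*2.+1 * (k.*2.+2 * a))%N; first by ring.
rewrite h1 h4; transitivity ((m - k) * d * (m - (3 * k).+2) * (k.*2.+1 * b))%N.
  by ring.
rewrite h3; transitivity ((m - k) * f * (d * (m - (3 * k).+1) * (m - (3 * k).+2)))%N.
  by ring.
by rewrite h2; ring.
Qed.

Lemma half_mod3 p m : prime p -> (3 < p)%N -> p = m.*2.+1 ->
  ((m %% 3 == 0) || (m %% 3 == 2))%N.
Proof.
move=> pr_p p3 p_m; have : ~~ (3 %| p)%N by rewrite dvdn_prime2 // neq_ltn p3.
by rewrite p_m; lia.
Qed.

Section Characteristic.
Variables (K : fieldType) (p m : nat).
Hypotheses (pr_p : prime p) (p3 : (3 < p)%N) (p_m : p = m.*2.+1).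
Hypothesis char_K : p \in [pchar K].

Lemma natf_neq0_small j : (0 < j)%N -> (j < p)%N -> j%:R != 0 :> K.
Proof.
move=> j0 jp; rewrite -(dvdn_pcharf char_K); apply/negP=> /(dvdn_leq j0).
by rewrite leqNgt jp.
Qed.

Lemma natf_fact_neq0 j : (j < p)%N -> (j`!)%:R != 0 :> K.
Proof.
elim: j => [|j IHj] jp; first by rewrite fact0 oner_eq0.
by rewrite factS natrM mulf_neq0 //; [apply: natf_neq0_small | rewrite IHj // ltnW].
Qed.

Lemma half_char : 2 * m%:R = -1 :> K.
Proof.
have := pcharf0 char_K; rewrite p_m -addn1 natrD -mul2n natrM => /eqP.
by rewrite addr_eq0 => /eqP.
Qed.

(** [m/3] is congruent to -1/6 or to -5/6 modulo p, according to the residue of m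
    modulo 3, and x (x + 1) takes the same value at both. *)
Lemma sixth_char : 36 * (m %/ 3)%:R * ((m %/ 3)%:R + 1) = -5 :> K.
Proof.
have m3 := half_mod3 pr_p p3 p_m.
have : 2 * m%:R = -1 :> K := half_char.
rewrite {1}(divn_eq m 3); move: (m %/ 3)%N => n.
case/orP: m3 => /eqP-> h.
  have -> : 36 * n%:R * (n%:R + 1) = (2 * (n * 3 + 0)%:R) * (6 * n%:R + 6) :> K.
    by rewrite addn0 natrM; ring.
  rewrite h; transitivity (- (2 * (n * 3 + 0)%:R) - 6 : K); last by rewrite h; ring.
  by rewrite addn0 natrM; ring.
have h' : 6 * n%:R = -5 :> K.
  transitivity (2 * (n * 3 + 2)%:R - 4 : K); last by rewrite h; ring.
  by rewrite natrD natrM; ring.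
transitivity ((6 * n%:R) * (6 * n%:R + 6) : K); first by ring.
by rewrite h'; ring.
Qed.

(** The k-th terms of the two expansions, cleared of denominators.  Induction on
    k with the two recursions: their ratios agree because m = -1/2 and
    n (n + 1) = -5/36 in K, where n = [m/3]. *)
Lemma legendre_curve_coef k : (k <= m %/ 3)%N ->
  (legendre_coef (m %/ 3) k)%:R * 27 ^+ k = (curve_coef m k)%:R * 4 ^+ k :> K.
Proof.
elim: k => [|k IHk] kn.
  by rewrite /legendre_coef /curve_coef !bin0 !expr0.
have km : (3 * k.+1 <= m)%N by have := leq_trunc_div m 3; lia.
have nz j : (j < k.*2.+2)%N -> j.+1%:R != 0 :> K.
  by move=> jk; apply: natf_neq0_small; rewrite // p_m; lia.
have k1 : k.+1%:R != 0 :> K by apply: nz; lia.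
have k2 : k.*2.+1%:R != 0 :> K by apply: nz; lia.
(* The factor 36 clears the denominators of m = -1/2 and n (n + 1) = -5/36. *)
have n36 : 36 != 0 :> K.
  rewrite (_ : 36 = (2 * 3) ^+ 2); last by ring.
  by rewrite expf_neq0 // mulf_neq0 // natf_neq0_small // ltnW.
have := curve_coef_recl m k; have := legendre_coef_recl (m %/ 3) k.
move: IHk => /(_ (ltnW kn)).
move: (legendre_coef _ k) (legendre_coef _ k.+1) (curve_coef _ k) (curve_coef _ k.+1).
move=> c c' d d' IHk /(congr1 (fun i : nat => i%:R : K)) hc.
move/(congr1 (fun i : nat => i%:R : K)) => hd.
move: hc hd; rewrite !natrM !natrB; try lia.
rewrite natrD => hc hd.
have kE : k.*2.+1%:R = 2 * k%:R + 1 :> K by rewrite -addn1 natrD -mul2n natrM.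
have kE' : k.*2.+2%:R = 2 * k.+1%:R :> K by rewrite -doubleS -mul2n natrM.
have k3 j : (3 * k + j)%:R = 3 * k%:R + j%:R :> K by rewrite natrD natrM.
apply: (mulfI n36); apply: (mulfI k2); apply: (mulfI k1); apply: (mulfI k1).
transitivity (27 * k.*2.+1%:R * (36 * (k.+1%:R * k.+1%:R * c'%:R)) * 27 ^+ k : K).
  by rewrite [27 ^+ _.+1]exprS; ring.
transitivity (72 * (k.+1%:R * (k.*2.+2%:R * k.*2.+1%:R) * d'%:R) * 4 ^+ k : K); last first.
  by rewrite kE' [4 ^+ _.+1]exprS; ring.
rewrite hc hd -[(3 * k).+2]addn2 -[(3 * k).+1]addn1 !k3 (natrM _ 3 k) kE.
rewrite -[k.+1]addn1 natrD.
transitivity (27 * (2 * k%:R + 1) * (36 * (m %/ 3)%:R * ((m %/ 3)%:R + 1)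
   - 36 * k%:R * (k%:R + 1)) * (c%:R * 27 ^+ k) : K); first by ring.
transitivity (9 * (2 * m%:R - 6 * k%:R) * (2 * m%:R - 6 * k%:R - 2)
   * (2 * m%:R - 6 * k%:R - 4) * (d%:R * 4 ^+ k) : K); last by ring.
by rewrite IHk sixth_char half_char; ring.
Qed.

Lemma curve_coef_small k : (m < 3 * k)%N -> curve_coef m k = 0%N.
Proof.
move=> mk; rewrite /curve_coef (bin_small (_ : m - k < k.*2)%N) ?muln0 //.
by lia.
Qed.

Lemma legendre_sum_coef t :
  3 ^+ m * legendre_sum (m %/ 3) t =
  (('X^2 * ('X + 3%:P) + (2 * (t - 1))%:P) ^+ m)`_m.*2 :> K.
Proof.
have K2 : 2 != 0 :> K by apply: natf_neq0_small; rewrite // ltnW.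
have nm : (m %/ 3 < m.+1)%N by rewrite ltnS leq_div.
rewrite (legendre_sum_wide t nm) mulr_sumr [in RHS]exprDn coef_sum.
apply: eq_bigr => k _; have km : (k <= m)%N by rewrite -ltnS.
rewrite coefMn -polyC_exp coefMC [('X^2 * _) ^+ _]exprMn -(exprM 'X 2) mul2n coefXnM.
rewrite ltnNge leq_double leq_subr /= -doubleB subKn // coef_XaddC_exp.
have [mk | ] := ltnP m (3 * k).
  have k3 : (m %/ 3 < k)%N by rewrite ltn_divLR // mulnC.
  rewrite legendre_coef_small // mul0r mulr0 -mulr_natr -[_ *+ 'C(_, k.*2)]mulr_natr.
  have := curve_coef_small mk; rewrite /curve_coef => /(congr1 (fun i => i%:R : K)).
  rewrite natrM => e; transitivity (3 ^+ (m - k - k.*2) * (2 * (t - 1)) ^+ k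
    * ('C(m, k)%:R * 'C(m - k, k.*2)%:R) : K); first by rewrite e mulr0.
  by ring.
move=> mk; have k3 : (k <= m %/ 3)%N by rewrite leq_divRL // mulnC.
have e := legendre_curve_coef k3.
have -> : 3 ^+ m = 3 ^+ (m - k - k.*2) * 27 ^+ k :> K.
  rewrite (_ : 27 = 3 ^+ 3); last by ring.
  by rewrite -exprM -exprD; congr (_ ^+ _); lia.
transitivity (3 ^+ (m - k - k.*2) * ((legendre_coef (m %/ 3) k)%:R * 27 ^+ k)
  * ((t - 1) / 2) ^+ k : K); first by ring.
rewrite e -mulrA -mulrA -exprMn (_ : 4 * _ = 2 * (t - 1)); last by field.
by rewrite /curve_coef natrM -[_ *+ 'C(m, k)]mulr_natr -[_ *+ 'C(_, k.*2)]mulr_natr; ring.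
Qed.
End Characteristic.

(** * From the Legendre polynomial to the trace *)

Lemma coef_comp_scaleX (R : comNzRingType) (q : {poly R}) (c : R) i :
  (q \Po (c *: 'X))`_i = c ^+ i * q`_i.
Proof.
rewrite coef_comp_poly.
under eq_bigr do rewrite exprZn coefZ coefXn.
have [qi | iq] := leqP (size q) i.
  rewrite (nth_default 0 qi) mulr0 big1 // => j _.
  by rewrite (_ : _ == _ = false) ?mulr0 //; have := ltn_ord j; lia.
rewrite (bigD1 (Ordinal iq)) //= eqxx mulr1 big1 ?addr0 1?mulrC // => j.
by rewrite -val_eqE /= eq_sym => /negPf->; rewrite !mulr0.
Qed.

Section CurveTrace.
Variables (F : finFieldType) (K : fieldType) (phi : {rmorphism F -> K}).
Variables (p m : nat) (s : K).
Hypotheses (pr_p : prime p) (p5 : (5 < p)%N) (p_m : p = m.*2.+1).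
Hypotheses (char_K : p \in [pchar K]) (card_F : #|F| = p) (s2 : s ^+ 2 = 5).
Let card_F' : #|F| = m.*2.+1. Proof. by rewrite card_F. Qed.

Lemma size_cubic_exp (q : {poly K}) : (size q <= 4)%N ->
  (size (q ^+ m)%R <= m.*2.*2)%N.
Proof.
move=> q4; apply: leq_trans (size_poly_exp_leq _ _) _.
by move: p5 q4; rewrite p_m; nia.
Qed.

Lemma size_cubic (a b c : K) : (size ('X^3 + a *: 'X^2 + b *: 'X + c%:P)%R <= 4)%N.
Proof.
rewrite -addrA -addrA.
rewrite (leq_trans (size_polyD _ _)) // geq_max size_polyXn /=.
rewrite (leq_trans (size_polyD _ _)) // geq_max.
rewrite (leq_trans (size_scale_leq _ _)) ?size_polyXn //=.
rewrite (leq_trans (size_polyD _ _)) // geq_max.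
rewrite (leq_trans (size_scale_leq _ _)) ?size_polyX //=.
by rewrite (leq_trans (size_polyC_leq1 _)).
Qed.

Lemma coef_cubic_translate t :
  (('X^2 * ('X + 3%:P) + (2 * (t - 1))%:P) ^+ m)`_m.*2 =
  (('X^3 - 3 *: 'X + (2 * t)%:P) ^+ m)`_m.*2 :> K.
Proof.
apply: oppr_inj; rewrite -!(sum_horner_coef card_F' phi); first last.
- apply: size_cubic_exp; rewrite (_ : _ + _ = 'X^3 + 3 *: 'X^2 + 0 *: 'X + (2 * (t - 1))%:P).
    exact: size_cubic.
  by rewrite scale0r addr0 mulrDr -exprSr [_ * 3%:P]mulrC mul_polyC.
- apply: size_cubic_exp; rewrite (_ : _ + _ = 'X^3 + 0 *: 'X^2 + (-3) *: 'X + (2 * t)%:P).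
    exact: size_cubic.
  by rewrite scale0r addr0 scaleNr.
rewrite [RHS](reindex_inj (addIr 1)) /=; apply: eq_bigr => x _.
rewrite !(hornerE, horner_exp) rmorphD rmorph1 /=; congr (_ ^+ _).
by ring.
Qed.

(** Substituting s X for X multiplies the coefficient by s^(2m); on the other hand
    it turns X^3 - 15 X + 22 into s^3 (X^3 - 3 X + 2 t) with t = 11 s / 25, since
    s^3 3 = 15 s and s^3 2 t = 22. *)
Lemma coef_cubic_twist :
  (('X^3 - 15 *: 'X + 22%:P) ^+ m)`_m.*2 =
  s ^+ m * (('X^3 - 3 *: 'X + (2 * (11 * s / 25))%:P) ^+ m)`_m.*2 :> K.
Proof.
have K5 : 5 != 0 :> K by apply: (natf_neq0_small char_K).
have s0 : s != 0 by apply: contraNneq K5 => s0; rewrite -s2 s0 expr0n.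
have K25 : 25 != 0 :> K by rewrite (_ : 25 = 5 * 5) ?mulf_neq0 //; ring.
set t := 11 * s / 25; have t_s : s ^+ 3 * (2 * t) = 22.
  transitivity ((s ^+ 2) ^+ 2 * 22 / 25); first by rewrite /t; field.
  by rewrite s2; field.
apply: (mulfI (expf_neq0 m.*2 s0)).
rewrite -coef_comp_scaleX mulrA -exprD -coefZ; congr (_`__).
rewrite (_ : m.*2 + m = 3 * m)%N; last by lia.
rewrite exprM -exprZn rmorphXn /=; congr (polyseq (_ ^+ m)).
rewrite comp_polyD comp_polyB comp_polyZ comp_polyX comp_polyC comp_Xn_poly.
rewrite exprZn scalerDr scalerBr !scalerA -[_ *: (2 * t)%:P]mul_polyC -polyCM t_s.
congr (_ - _ *: _ + _); transitivity (s ^+ 2 * 3 * s); last by ring.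
by rewrite s2; ring.
Qed.

(** Both sides are the coefficient of X^(2m) in (X^3 - 15 X + 22)^m: the left one
    by coef_cubic_twist, the right one because, by Euler's criterion, the values
    of this polynomial over F are those of chi (x^3 - 15 x + 22). *)
Lemma legendre_sum_trace :
  s ^+ m * (3 ^+ m * legendre_sum (m %/ 3) (11 * s / 25)) =
  - (\sum_(x : F) quad_char (x ^+ 3 - 15 * x + 22))%:~R :> K.
Proof.
rewrite (legendre_sum_coef pr_p _ p_m char_K) ?coef_cubic_translate; last by lia.
rewrite -coef_cubic_twist.
apply: oppr_inj; rewrite opprK -(sum_horner_coef card_F' phi); last first.
  apply: size_cubic_exp; rewrite (_ : _ + _ = 'X^3 + 0 *: 'X^2 + (-15) *: 'X + 22%:P).
    exact: size_cubic.
  by rewrite scale0r addr0 scaleNr.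
rewrite -(rmorph_int phi) rmorph_sum /= rmorph_sum; apply: eq_bigr => x _ /=.
rewrite (Euler_criterion card_F') rmorphXn horner_exp; congr (_ ^+ _).
rewrite hornerD hornerC hornerD hornerN hornerXn hornerZ hornerX.
by rewrite [RHS]rmorphD rmorphB rmorphXn rmorphM !rmorph_nat.
Qed.
End CurveTrace.

(** * Integral values and the square root of 5 *)

Lemma horner_legendre_poly n x : (legendre_poly n).[x] = legendre_sum n x.
Proof.
have C2 : 2 != 0 :> algC by rewrite pnatr_eq0.
suff [] : (legendre_poly n).[x] = legendre_sum n x /\
          (legendre_poly n.+1).[x] = legendre_sum n.+1 x by [].
elim: n => [|n [IHn IHn1]].
  by rewrite legendre_poly0 legendre_poly1 hornerC hornerX legendre_sum0 legendre_sum1.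
split=> //; apply: (mulfI (_ : n.+2%:R != 0)); first by rewrite pnatr_eq0.
rewrite legendre_sum_rec // -hornerZ legendre_poly_rec // hornerD hornerN.
rewrite !hornerZ mulrC hornerM hornerX /= IHn IHn1 -(_ : n.*2.+3 = 2 * n.+1 + 1)%N.
  by ring.
by lia.
Qed.

(** The integers W_n = (5 s)^n n! P_n(11 s / 25), where s^2 = 5. *)
Fixpoint scaled_legendre (n : nat) : int :=
  match n with
  | 0%N => 1
  | m.+1 =>
    match m with
    | 0%N => 11
    | k.+1 => (2 * m + 1)%N%:Z * 11 * scaled_legendre m
              - (m ^ 2)%N%:Z * 125 * scaled_legendre k
    end
  end.

Lemma scaled_legendre_rec n : scaled_legendre n.+2 =
  n.*2.+3%:Z * 11 * scaled_legendre n.+1 - (n.+1 ^ 2)%N%:Z * 125 * scaled_legendre n.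
Proof. by rewrite /= (_ : 2 * n.+1 + 1 = n.*2.+3)%N //; lia. Qed.

Lemma scaled_legendreE (K : fieldType) (s : K) n :
    2 != 0 :> K -> 5 != 0 :> K -> s ^+ 2 = 5 ->
  (scaled_legendre n)%:~R = (5 * s) ^+ n * (n`!)%:R * legendre_sum n (11 * s / 25).
Proof.
move=> K2 K5 s2; have K25 : 25 != 0 :> K.
  by rewrite (_ : 25 = 5 * 5) ?mulf_neq0 //; ring.
set t := 11 * s / 25; have st : 5 * s * t = 11.
  by transitivity (s ^+ 2 * 55 / 25); [rewrite /t | rewrite s2]; field.
have s25 : (5 * s) ^+ 2 = 125 by rewrite exprMn s2; ring.
suff [] : (scaled_legendre n)%:~R = (5 * s) ^+ n * (n`!)%:R * legendre_sum n t /\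
  (scaled_legendre n.+1)%:~R = (5 * s) ^+ n.+1 * (n.+1`!)%:R * legendre_sum n.+1 t by [].
elim: n => [|n [IHn IHn1]].
  by rewrite legendre_sum0 legendre_sum1 // expr0 expr1 !mulr1 st.
split=> //; rewrite scaled_legendre_rec rmorphB !rmorphM /= IHn IHn1.
transitivity ((5 * s) ^+ n.+2 * (n.+1)`!%:R * (n.+2%:R * legendre_sum n.+2 t)); last first.
  by rewrite [n.+2`!]factS natrM; ring.
rewrite legendre_sum_rec // factS natrM -!pmulrn natrM.
transitivity (n.*2.+3%:R * (5 * s * t)
    * ((5 * s) ^+ n.+1 * (n.+1%:R * (n`!)%:R) * legendre_sum n.+1 t)
  - n.+1%:R * n.+1%:R * (5 * s) ^+ 2 * ((5 * s) ^+ n * (n`!)%:R * legendre_sum n t)); last first.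
  by rewrite !exprS expr0; ring.
by rewrite st s25; ring.
Qed.

Lemma exists_sqrt_extension (F : finFieldType) (a : F) :
  exists (K : fieldType) (phi : {rmorphism F -> K}) (s : K), s ^+ 2 = phi a.
Proof.
have q0 : 'X^2 - a%:P != 0 :> {poly F}.
  by rewrite -size_poly_eq0 size_XnsubC.
have [L [rs dvd_rs _]] := FinSplittingFieldFor q0.
have : size rs = 2%N.
  have := eqp_size dvd_rs; rewrite size_prod_XsubC size_map_poly size_XnsubC //.
  by case.
case: rs dvd_rs => // s rs dvd_rs _; exists L, (GRing.in_alg L), s.
have : root (map_poly (GRing.in_alg L) ('X^2 - a%:P)) s.
  by rewrite (eqp_root dvd_rs) root_prod_XsubC mem_head.
by rewrite rmorphB /= map_polyXn map_polyC /root !hornerE subr_eq0 => /eqP.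
Qed.

(** Reduction to integers: since d is prime to p, the number (N - d M) / d lies in
    p R_p. *)
Lemma eqmod_of_int_eq (p : nat) (x : algC) (d N M : int) (e : bool) :
    prime p -> ~~ (p %| d)%Z -> (p %| N - d * M)%Z ->
    d%:~R * x = N%:~R * sqrtC 5 ^+ e ->
  eqmod_Rp_sqrt5 p x (M%:~R * sqrtC 5 ^+ e).
Proof.
move=> pr_p pd /dvdzP[q NdM] dx.
have d0 : d != 0 by apply: contraNneq pd => ->; rewrite dvdz0.
have dC : d%:~R != 0 :> algC by rewrite intr_eq0.
pose r : rat := q%:~R / d%:~R.
have r_p : r \in Rp p.
  rewrite unfold_in /r; case: divqP d0 pd => [|k y k0 _ pd]; first by rewrite eqxx.
  rewrite coprime_sym prime_coprime //; apply: contra pd => pd.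
  by rewrite dvdz_mull // dvdzE.
have r0 : (0 : rat) \in Rp p by rewrite unfold_in coprime1n.
exists (ratr r * sqrtC 5 ^+ e).
  case: e {dx}; [exists 0, r | exists r, 0]; split=> //.
    by rewrite rmorph0 add0r expr1.
  by rewrite rmorph0 mul0r addr0 mulr1.
have NE : N = d * M + q * p%:Z by rewrite -NdM; ring.
have rE : ratr r = q%:~R / d%:~R :> algC by rewrite /r rmorphM fmorphV /= !ratr_int.
apply: (mulfI dC); rewrite mulrBr dx rE NE rmorphD !rmorphM /=.
by field.
Qed.

(** * The congruence *)

(** -3 = (1 + 2 w)^2 for a primitive cube root of unity w. *)
Lemma quad_char_N3 (F : finFieldType) (m r : nat) : #|F| = m.*2.+1 ->
  m.*2 = (3 * r)%N -> 3 != 0 :> F -> quad_char (-3 : F) = 1.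
Proof.
move=> card_F order_F F3; have [g g_prim] := exists_generator card_F.
have r0 : (0 < r)%N by have := double_half_gt0 card_F; lia.
pose w := g ^+ r.
have w3 : w ^+ 3 = 1 by rewrite -exprM mulnC -order_F (prim_expr_order g_prim).
have w1 : w - 1 != 0.
  rewrite subr_eq0 -(expr0 g) (eq_prim_root_expr g_prim) mod0n modn_small; lia.
have w2 : w ^+ 2 = - w - 1.
  apply: (mulfI w1); transitivity (w ^+ 3 - w ^+ 2); first by ring.
  by rewrite w3; ring.
have sq : -3 = (1 + 2 * w) ^+ 2.
  transitivity (1 + 4 * w + 4 * (w ^+ 2)); last by ring.
  by rewrite w2; ring.
rewrite sq quad_char_sqr //; apply: contraNneq F3 => w0.
by rewrite -oppr_eq0 sq w0 expr0n.
Qed.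

(** 2 q - 1 is divisible by 3, and x^(2q-1) = x for all x. *)
Lemma cube_inj (F : finFieldType) (k : nat) : #|F| = (3 * k + 2)%N ->
  injective (fun x : F => x ^+ 3).
Proof.
move=> cF; apply: (can_inj (g := fun y => y ^+ (2 * k).+1)) => x.
have e : (#|F| + #|F| = (3 * (2 * k).+1).+1)%N by rewrite cF; lia.
have [-> | x0] := eqVneq x 0; first by rewrite !expr0n.
by apply: (mulfI x0); rewrite -exprM -exprS -e exprD expf_card.
Qed.

Lemma legendre_symbolE (p : nat) : prime p -> (5 < p)%N ->
  legendre_symbol 5 p = quad_char (5 : 'F_p).
Proof.
move=> pr_p p5; rewrite /legendre_symbol /quad_char -(dvdn_pcharf (pchar_Fp pr_p)).
by rewrite dvdzE.
Qed.

Section Prime.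
Variables (p m : nat).
Hypotheses (pr_p : prime p) (p5 : (5 < p)%N) (p_m : p = m.*2.+1).
Let card_F : #|'F_p| = m.*2.+1. Proof. by rewrite card_Fp. Qed.
Let char_F := pchar_Fp pr_p.

Lemma third_half_parity : (m = m %/ 3 + ((m - m %/ 3)./2).*2)%N.
Proof.
have := half_mod3 pr_p (ltnW (ltnW p5)) p_m.
by rewrite halfK; have := leq_trunc_div m 3; lia.
Qed.

(** m - n is even, so that s^(m-n) is a power of 5 and s disappears from the
    identity between s^m 3^m P_n and - S. *)
Lemma scaled_legendre_trace :
  (5 ^+ (m - m %/ 3)./2 * 3 ^+ m * (scaled_legendre (m %/ 3))%:~R : 'F_p) =
  - (5 ^+ (m %/ 3) * ((m %/ 3)`!)%:R *
     (\sum_(x : 'F_p) quad_char (x ^+ 3 - 15 * x + 22))%:~R).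
Proof.
have [K [phi [s]]] := exists_sqrt_extension (5 : 'F_p); rewrite rmorph_nat => s2.
have char_K : p \in [pchar K] by apply: (rmorph_pchar phi).
apply: (fmorph_inj phi).
rewrite rmorphN !rmorphM !rmorphXn !rmorph_nat !rmorph_int /=.
have := legendre_sum_trace phi pr_p p5 p_m char_K (card_Fp pr_p) s2.
set S := _%:~R => tr; set n := (m %/ 3)%N; set j := (m - n)./2.
rewrite (@scaled_legendreE K s) // ?(natf_neq0_small char_K) //; try by lia.
have mj : (m = n + j.*2)%N := third_half_parity.
have s0 : s != 0.
  apply: contraTneq (natf_neq0_small char_K (isT : 0 < 5)%N p5) => s0.
  by rewrite -s2 s0 expr0n eqxx.
apply: oppr_inj; rewrite opprK; transitivity (5 ^+ n * n`!%:R * - - S); last by rewrite opprK.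
by rewrite -tr {2}mj exprD -mul2n [s ^+ (2 * j)]exprM s2 exprMn; ring.
Qed.

(** The three cases of the theorem at once.  The power of sqrt 5 that remains in
    P_n(11 sqrt 5 / 25) is given by the parity of n, which is that of m; S = 0
    corresponds to A = 0. *)
Lemma legendre_eqmod (A : int) :
    \sum_(x : 'F_p) quad_char (x ^+ 3 - 15 * x + 22) = - (2 * A) ->
  eqmod_Rp_sqrt5 p (legendre_poly (p %/ 6)).[11 * sqrtC 5 / 25]
    ((quad_char (3 : 'F_p) * 5 ^+ (m - odd m)./2 * legendre_symbol 5 p * (2 * A))%:~R
     * sqrtC 5 ^+ odd m).
Proof.
move=> SA; set n := (m %/ 3)%N; set j := (m - n)./2.
have mj : (m = n + j.*2)%N := third_half_parity.
have pn : (p %/ 6)%N = n by rewrite /n p_m; lia.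
have on : odd n = odd m by rewrite mj oddD odd_double addbF.
have F5 : 5 != 0 :> 'F_p by apply: (natf_neq0_small char_F).
(* d is (5 sqrt 5)^n n!, times sqrt 5 if n is odd. *)
pose d : int := 5 ^+ n * 5 ^+ (n + odd m)./2 * (n`!)%:Z.
apply: (eqmod_of_int_eq (d := d) (N := scaled_legendre n)) => //.
- rewrite (dvdz_pcharf char_F) /d !rmorphM !rmorphXn /= -pmulrn.
  rewrite !mulf_neq0 ?expf_neq0 // (natf_fact_neq0 char_F) // p_m /n; lia.
- rewrite (dvdz_pcharf char_F) rmorphB subr_eq0; apply/eqP.
  have F3 : 3 != 0 :> 'F_p by apply: (natf_neq0_small char_F); lia.
  have := scaled_legendre_trace; rewrite SA -/n -/j => tr.
  have u0 : (5 : 'F_p) ^+ j * 3 ^+ m != 0 by rewrite mulf_neq0 ?expf_neq0.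
  apply: (mulfI u0); rewrite tr /d legendre_symbolE // !(rmorphM, rmorphXn, rmorphN) /=.
  rewrite !(Euler_criterion card_F).
  (* The exponents add up to 2 m. *)
  have fives : 5 ^+ j * 5 ^+ (n + odd m)./2 * 5 ^+ (m - odd m)./2 * 5 ^+ m = 1 :> 'F_p.
    rewrite -!exprD (_ : _ + m = m.*2)%N ?(expf_order card_F) //.
    by have := odd_double_half m; have := odd_double_half n; rewrite on; lia.
  have threes : 3 ^+ m * 3 ^+ m = 1 :> 'F_p.
    by rewrite -exprD addnn (expf_order card_F).
  rewrite -!pmulrn; set u := 5 ^+ n * _; set v := 2%:R * _.
  transitivity ((3 ^+ m * 3 ^+ m) * (5 ^+ j * 5 ^+ (n + odd m)./2 * 5 ^+ (m - odd m)./2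
    * 5 ^+ m) * (u * v) : 'F_p); last by rewrite /u; ring.
  by rewrite threes fives; ring.
rewrite pn horner_legendre_poly.
have [C2 C5] : 2 != 0 :> algC /\ 5 != 0 :> algC by rewrite !pnatr_eq0.
rewrite (scaled_legendreE n C2 C5 (sqrtCK 5)) /d !(rmorphM, rmorphXn) /= -!pmulrn.
have -> : 5 ^+ (n + odd m)./2 = sqrtC 5 ^+ (n + odd m) :> algC.
  rewrite -[in LHS](sqrtCK 5) -exprM mul2n halfK; congr (_ ^+ _).
  by rewrite oddD on; case: (odd m); rewrite /= subn0.
by rewrite exprD exprMn; ring.
Qed.

Lemma curve_sum_split (A B : int) : (p = 1 %[mod 3])%N ->
    p%:Z = A ^+ 2 + 3 * B ^+ 2 -> (3 %| A - 1)%Z ->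
  \sum_(x : 'F_p) quad_char (x ^+ 3 - 15 * x + 22) = - (2 * A).
Proof.
move=> p1 pAB A3; have F3 : 3 != 0 :> 'F_p by apply: (natf_neq0_small char_F); lia.
have order_F : m.*2 = (3 * (m.*2 %/ 3))%N.
  by rewrite mulnC divnK //; move: p1; rewrite p_m; lia.
have [b nrm] := cubic_sum_norm card_F order_F.
have [g g_prim] := exists_generator card_F.
rewrite (sum_quad_char_curve card_F F3) -/(cubic_sum 1).
apply: (cubic_sum_eq pr_p pAB A3 (b := b)).
- by rewrite nrm card_Fp.
- exact: (cubic_sum_mod3 card_F order_F g_prim).
- exact: (cubic_sum_even card_F order_F g_prim).
Qed.

Lemma curve_sum_inert : (p = 2 %[mod 3])%N ->
  \sum_(x : 'F_p) quad_char (x ^+ 3 - 15 * x + 22) = 0.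
Proof.
move=> p2; have F3 : 3 != 0 :> 'F_p by apply: (natf_neq0_small char_F); lia.
rewrite (sum_quad_char_curve card_F F3).
apply: (sum_quad_char_cubic_bij card_F); apply: (@cube_inj _ (p %/ 3)).
by rewrite card_Fp //; lia.
Qed.

(** chi (-3) = 1, and chi (-1) = (-1)^m. *)
Lemma quad_char_3 : (p = 1 %[mod 3])%N -> quad_char (3 : 'F_p) = (-1) ^+ m.
Proof.
move=> p1; have F3 : 3 != 0 :> 'F_p by apply: (natf_neq0_small char_F); lia.
have [g g_prim] := exists_generator card_F.
rewrite (_ : 3 = -1 * -3); last by rewrite mulrNN mul1r.
rewrite (quad_charM card_F) -(generator_half card_F g_prim).
rewrite (quad_char_generator card_F g_prim) (@quad_char_N3 _ m (m.*2 %/ 3)) ?mulr1 //.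
by rewrite mulnC divnK //; move: p1; rewrite p_m; lia.
Qed.
End Prime.

Theorem corollary2p3 (p : nat) (hp : prime p) (hp5 : (5 < p)%N) :
  [/\ (p = 1 %[mod 12])%N ->
        forall A B : int, p%:Z = A ^+ 2 + 3 * B ^+ 2 -> (3 %| A - 1)%Z ->
        eqmod_Rp_sqrt5 p
          (legendre_poly (p %/ 6)).[11 * sqrtC 5 / 25]
          (5 ^+ ((p - 1) %/ 4) * (legendre_symbol 5 p)%:~R * (2 * A%:~R)),
      (p = 7 %[mod 12])%N ->
        forall A B : int, p%:Z = A ^+ 2 + 3 * B ^+ 2 -> (3 %| A - 1)%Z ->
        eqmod_Rp_sqrt5 p
          (legendre_poly (p %/ 6)).[11 * sqrtC 5 / 25]
          (- 5 ^+ ((p - 3) %/ 4) * (legendre_symbol 5 p)%:~R * (2 * A%:~R)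
             * sqrtC 5)
    & (p = 2 %[mod 3])%N ->
        eqmod_Rp_sqrt5 p (legendre_poly (p %/ 6)).[11 * sqrtC 5 / 25] 0].
Proof.
have p_m : p = (p./2).*2.+1.
  case: (even_prime hp) => [p2 | op]; first by rewrite p2 in hp5.
  by rewrite -[LHS]odd_double_half op.
split=> [p1 A B pAB A3 | p7 A B pAB A3 | p2].
- have p13 : (p = 1 %[mod 3])%N by lia.
  have := legendre_eqmod hp hp5 p_m (curve_sum_split hp hp5 p_m p13 pAB A3).
  have om : odd p./2 = false by lia.
  rewrite (quad_char_3 hp hp5 p_m p13) -signr_odd om mul1r mulr1 subn0.
  rewrite (_ : (p - 1) %/ 4 = p./2./2)%N; last by lia.
  by rewrite !(rmorphM, rmorphXn).
- have p13 : (p = 1 %[mod 3])%N by lia.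
  have := legendre_eqmod hp hp5 p_m (curve_sum_split hp hp5 p_m p13 pAB A3).
  have om : odd p./2 by lia.
  rewrite (quad_char_3 hp hp5 p_m p13) -signr_odd om expr1 mulN1r.
  rewrite (_ : (p - 3) %/ 4 = (p./2 - true)./2)%N; last by lia.
  by rewrite !(rmorphN, rmorphM, rmorphXn).
have := @legendre_eqmod _ _ hp hp5 p_m 0; rewrite !mulr0 oppr0 mul0r.
apply.
exact: curve_sum_inert hp hp5 p_m p2.
Qed.
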